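(* Let $n$ be an even positive integer, let $\omega_n=\exp(2\pi\sqrt{-1}/n)$, let $\Omega=(\omega_n^{ij})_{i,j=0}^{n-1}$ be the $n\times n$ matrix of the discrete Fourier transform, and let $\Omega^{(q)}=(\omega_n^{ij})_{i,j=0}^{q-1}$ denote its $q\times q$ leading (that is, northwestern) block for $q=n/2$. Then $\kappa(\Omega^{(q)})\ge 2^{n/4-1}\sqrt n$.
   Context: For a nonsingular matrix $M$, $\kappa(M)=\|M\|\,\|M^{-1}\|$, where $\|\cdot\|$ is the spectral norm. *)

(* Defs.v *)
From HB Require Import structures.
From mathcomp Require Import all_boot all_order all_algebra.
From mathcomp Require Import complex.
From mathcomp Require Import classical_sets reals sequences exp trigo.

Set Implicit Arguments.
Unset Strict Implicit.
Unset Printing Implicit Defensive.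

Import Order.TTheory GRing.Theory Num.Theory.
Local Open Scope ring_scope.
Local Open Scope complex_scope.
Local Open Scope classical_set_scope.

(* exp (a + b i) = e^a (cos b + i sin b) *)
Definition cexp (R : realType) (z : R[i]) : R[i] :=
  (expR (complex.Re z) * cos (complex.Im z))
    +i* (expR (complex.Re z) * sin (complex.Im z)).

Definition omega (R : realType) (n : nat) : R[i] :=
  cexp (0 +i* (2 * pi / n%:R)).

Definition dft_mx (R : realType) (n : nat) : 'M[R[i]]_n :=
  \matrix_(i < n, j < n) omega R n ^+ (i * j).

Definition leading_block (T : Type) (n q : nat) (le_qn : (q <= n)%N)
    (A : 'M[T]_n) : 'M[T]_q :=
  mxsub (widen_ord le_qn) (widen_ord le_qn) A.

Definition norm2 (R : realType) (n : nat) (x : 'cV[R[i]]_n) : R :=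
  Num.sqrt (\sum_(i < n) ComplexField.Normc.normc (x i 0) ^+ 2).

(* The set is nonempty and bounded when 0 < n, so the sup is a true supremum;
   for n = 0 it is the conventional value sup set0 = 0. *)
Definition spectral_norm (R : realType) (m n : nat) (A : 'M[R[i]]_(m, n)) : R :=
  sup [set norm2 (A *m x) | x in [set x : 'cV[R[i]]_n | norm2 x = 1]].

(* Meaningful only for M \in unitmx, as invmx M = M otherwise. *)
Definition kappa (R : realType) (n : nat) (M : 'M[R[i]]_n) : R :=
  spectral_norm M * spectral_norm (invmx M).

Lemma half_le (n : nat) : (n./2 <= n)%N.
Proof. by rewrite leq_half_double -addnn -addnS leq_addr. Qed.

(* Main.v *)
Require Import Defs.
From mathcomp Require Import all_boot all_order all_algebra.
From mathcomp Require Import complex.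
From mathcomp Require Import boolp classical_sets reals sequences exp trigo.
From mathcomp Require Import ring lra zify.
Import Order.TTheory GRing.Theory Num.Theory.
Local Open Scope ring_scope.
Import ComplexField.Normc.

Set Implicit Arguments.
Unset Strict Implicit.

(* For nonzero vectors x and y, kappa M >= (|M x| / |x|) (|y| / |M y|).  Write
   n = 2 q and w = omega_n.  Take for x a basis vector, so that |M x| = sqrt q,
   and for y the coefficients of p = prod_(r < q, r <> k) (X - w^r) with
   k = q/2.  Then M y has the single nonzero entry p(w^k), while
   |y| >= |p(- w^k)| / sqrt q because |w| = 1.  The derivative of X^q - 1 at
   w^(2k) gives |p(w^k)| |p(- w^k)| = q, hence kappa M >= |p(- w^k)|^2 / q with
   |p(- w^k)|^2 = prod_(r <> k) 2 (1 + cos (pi (r - k) / q)).  All these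
   cosines are nonnegative and about half of them are at least 7/10, which is
   enough for q = 1 and q >= 4.  The cases q = 2 and q = 3 need better test
   vectors. *)

(** * Complex moduli and finite sums *)

Lemma normc_ge0 (R : rcfType) (z : R[i]) : 0 <= normc z.
Proof. by case: z => a b; exact: sqrtr_ge0. Qed.

Lemma normc_sqr (R : rcfType) (z : R[i]) :
  normc z ^+ 2 = complex.Re z ^+ 2 + complex.Im z ^+ 2.
Proof. by case: z => a b; rewrite /= sqr_sqrtr // addr_ge0 ?sqr_ge0. Qed.

Lemma normcX (R : rcfType) (z : R[i]) m : normc (z ^+ m) = normc z ^+ m.
Proof.
elim: m => [|m IHm]; first by rewrite !expr0 normc1.
by rewrite !exprS normcM IHm.
Qed.

Lemma normc_prod (R : rcfType) (I : Type) (s : seq I) (P : pred I)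
    (F : I -> R[i]) :
  normc (\prod_(i <- s | P i) F i) = \prod_(i <- s | P i) normc (F i).
Proof. by apply: (big_morph _ (@normcM R)); rewrite normc1. Qed.

Lemma ler_normc_sum (R : rcfType) (I : Type) (s : seq I) (P : pred I)
    (F : I -> R[i]) :
  normc (\sum_(i <- s | P i) F i) <= \sum_(i <- s | P i) normc (F i).
Proof.
elim/big_rec2: _ => [|i y x _ le_xy]; first by rewrite normc0.
by apply: le_trans (le_normcD _ _) _; rewrite lerD2l.
Qed.

(** Cauchy-Schwarz against the all-ones vector: the squared deviations from the mean [c] have a
    nonnegative sum. *)
Lemma sqr_sum_le (R : realFieldType) m (a : 'I_m -> R) :
  (\sum_(i < m) a i) ^+ 2 <= m%:R * \sum_(i < m) a i ^+ 2.
Proof.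
case: m a => [|m] a; first by rewrite !big_ord0 expr0n mulr0.
set S := \sum_(i < m.+1) a i; pose c := S / m.+1%:R.
have m_neq0 : m.+1%:R != 0 :> R by rewrite pnatr_eq0.
have: 0 <= \sum_(i < m.+1) (a i - c) ^+ 2.
  by apply: sumr_ge0 => i _; exact: sqr_ge0.
under eq_bigr do rewrite sqrrB.
rewrite big_split sumrB /= sumrMnl -mulr_suml -/S sumr_const card_ord.
rewrite -[_ *+ m.+1]mulr_natl => /(mulr_ge0 (ler0n R m.+1)).
suff -> : m.+1%:R * (\sum_(i < m.+1) a i ^+ 2 - S * c *+ 2 + m.+1%:R * c ^+ 2)
   = m.+1%:R * (\sum_(i < m.+1) a i ^+ 2) - S ^+ 2 by rewrite subr_ge0.
have id (T U d : R) : d != 0 ->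
    d * (T - U * (U / d) *+ 2 + d * (U / d) ^+ 2) = d * T - U ^+ 2.
  by move=> d_neq0; field.
exact: id.
Qed.

(** * Euclidean norm, spectral norm and condition number *)

Lemma norm2_ge0 (R : realType) m (x : 'cV[R[i]]_m) : 0 <= norm2 x.
Proof. exact: sqrtr_ge0. Qed.

Lemma norm2_sqr (R : realType) m (x : 'cV[R[i]]_m) :
  norm2 x ^+ 2 = \sum_(i < m) normc (x i 0) ^+ 2.
Proof. by rewrite sqr_sqrtr //; apply: sumr_ge0 => i _; exact: sqr_ge0. Qed.

Lemma norm2_eq0 (R : realType) m (x : 'cV[R[i]]_m) : norm2 x = 0 -> x = 0.
Proof.
move=> x0; have := norm2_sqr x; rewrite x0 expr0n /= => /esym/eqP.
rewrite psumr_eq0 => [/allP x_eq0|i _]; last exact: sqr_ge0.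
apply/matrixP => i j; rewrite ord1 mxE; apply: eq0_normc; apply/eqP.
by have := x_eq0 i (mem_index_enum i); rewrite sqrf_eq0.
Qed.

Lemma norm2Z (R : realType) m (c : R[i]) (x : 'cV[R[i]]_m) :
  norm2 (c *: x) = normc c * norm2 x.
Proof.
apply/eqP; rewrite -(@eqrXn2 _ 2) ?mulr_ge0 ?normc_ge0 ?norm2_ge0 //.
rewrite exprMn !norm2_sqr mulr_sumr; apply/eqP/eq_bigr => i _.
by rewrite mxE normcM exprMn.
Qed.

Lemma normc_le_norm2 (R : realType) m (x : 'cV[R[i]]_m) i :
  normc (x i 0) <= norm2 x.
Proof.
rewrite -(@ler_pXn2r _ 2) ?nnegrE ?normc_ge0 ?norm2_ge0 // norm2_sqr.
by rewrite (bigD1 i) //= lerDl; apply: sumr_ge0 => j _; exact: sqr_ge0.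
Qed.

(** Entries of a unit vector have modulus at most 1, so each entry of [A *m x] is bounded by the sum
    of the moduli in its row. *)
Lemma spectral_norm_ubound (R : realType) m n (A : 'M[R[i]]_(m, n)) :
  has_ubound
    [set norm2 (A *m x) | x in [set x : 'cV[R[i]]_n | norm2 x = 1]]%classic.
Proof.
exists (Num.sqrt (\sum_(i < m) (\sum_(j < n) normc (A i j)) ^+ 2)).
move=> _ [x /= x1 <-]; apply: ler_wsqrtr; apply: ler_sum => i _.
rewrite ler_pXn2r ?nnegrE ?normc_ge0 //; last first.
  by apply: sumr_ge0 => j _; exact: normc_ge0.
rewrite mxE; apply: le_trans (ler_normc_sum _ _ _) _; apply: ler_sum => j _.
by rewrite normcM ler_piMr ?normc_ge0 // -x1 normc_le_norm2.
Qed.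

Lemma norm2_mulmx_le (R : realType) m n (A : 'M[R[i]]_(m, n)) x :
  norm2 (A *m x) <= spectral_norm A * norm2 x.
Proof.
have norm2_0 p : norm2 (0 : 'cV[R[i]]_p) = 0.
  by rewrite -(scale0r 0) norm2Z normc0 mul0r.
have [x0|x_neq0] := eqVneq (norm2 x) 0.
  by rewrite (norm2_eq0 x0) mulmx0 !norm2_0 mulr0.
have x_gt0 : 0 < norm2 x by rewrite lt_def x_neq0 norm2_ge0.
have norm_inv : normc ((norm2 x)^-1)%:C%C = (norm2 x)^-1.
  by rewrite /= expr0n addr0 sqrtr_sqr ger0_norm // invr_ge0 norm2_ge0.
have -> : norm2 (A *m x) = norm2 (A *m (((norm2 x)^-1)%:C%C *: x)) * norm2 x.
  by rewrite -scalemxAr norm2Z norm_inv mulrAC mulVf // mul1r.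
rewrite ler_pM2r //; apply: ub_le_sup; first exact: spectral_norm_ubound.
by exists (((norm2 x)^-1)%:C%C *: x) => //=; rewrite norm2Z norm_inv mulVf.
Qed.

Lemma spectral_norm_ge0 (R : realType) m n (A : 'M[R[i]]_(m, n)) :
  0 <= spectral_norm A.
Proof.
rewrite /spectral_norm; set E := (X in sup X).
(* Without unit vectors, as in dimension 0, [sup] takes its default value 0. *)
have [[[_ [x x1 _]] _]|/sup_out -> //] := pselect (has_sup E).
apply: le_trans (norm2_ge0 (A *m x)) _.
by apply: ub_le_sup; [exact: spectral_norm_ubound|exists x].
Qed.

(** Multiplies the operator bounds for [M] at [x] and for [invmx M] at [M *m y]. The form without
    quotients allows zero vectors. *)
Lemma kappa_lower_bound (R : realType) m (M : 'M[R[i]]_m) (x y : 'cV_m) :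
  M \in unitmx ->
  norm2 (M *m x) * norm2 y <= kappa M * (norm2 x * norm2 (M *m y)).
Proof.
move=> Mu; rewrite /kappa mulrACA.
apply: ler_pM; rewrite ?norm2_ge0 ?norm2_mulmx_le //.
by rewrite -{1}(mulKmx Mu y) norm2_mulmx_le.
Qed.

(** * Powers of the root of unity of order 2q *)

Lemma omegaX (R : realType) q j :
  omega R q.*2 ^+ j = (cos (j%:R * (pi / q%:R)) +i* sin (j%:R * (pi / q%:R)))%C.
Proof.
have -> : omega R q.*2 = (cos (pi / q%:R) +i* sin (pi / q%:R))%C.
  rewrite /omega /cexp /= expR0 !mul1r -mul2n natrM invfM mulrACA divff ?mul1r //.
  by rewrite pnatr_eq0.
(* [pi] unfolds to a sum, which [mulrDl] would otherwise distribute over. *)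
move: (pi / q%:R) => t.
elim: j => [|j IHj]; first by rewrite expr0 mul0r cos0 sin0.
rewrite exprS {}IHj -nat1r mulrDl mul1r cosD sinD.
by apply/eqP; rewrite eq_complex /= eqxx addrC eqxx.
Qed.

Lemma normc_omegaX (R : realType) q j : normc (omega R q.*2 ^+ j) = 1.
Proof. by rewrite omegaX /= cos2Dsin2 sqrtr1. Qed.

Lemma normc_omegaD (R : realType) q k r :
  normc (omega R q.*2 ^+ k + omega R q.*2 ^+ r) ^+ 2 =
  2 * (1 + cos ((r%:R - k%:R) * (pi / q%:R))).
Proof.
rewrite normc_sqr !omegaX /=; move: (pi / q%:R) => t; rewrite mulrBl cosB.
move: (k%:R * t) (r%:R * t) => a b.
have := cos2Dsin2 a; have := cos2Dsin2 b; nra.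
Qed.

Lemma omega2_prim (R : realType) q :
  (0 < q)%N -> q.-primitive_root (omega R q.*2 ^+ 2).
Proof.
move=> q_gt0; have q_gt0' : 0 < q%:R :> R by rewrite ltr0n.
apply/andP; split=> //; apply/forallP => i; rewrite unity_rootE -exprM mulnC.
apply/eqP; have [->|i_neq] := eqVneq i.+1 q.
  have q_pi : q%:R * (pi / q%:R) = pi :> R by rewrite mulrC divfK ?gt_eqF.
  rewrite exprM omegaX q_pi cospi sinpi expr2 eq_complex /= mulrNN.
  by rewrite !(mul1r, mulr0, mul0r, subr0, addr0) !eqxx.
(* For 0 < j < q, w^(2j) = 1 would force w^j = 1 or w^j = -1, but w^j has imaginary part sin (j pi /
   q) > 0. *)
rewrite exprM sqrf_eq1 omegaX.
have: 0 < sin (i.+1%:R * (pi / q%:R) : R).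
  have pi_gt0 := pi_gt0 R.
  rewrite sin_gt0_pi // mulr_gt0 ?divr_gt0 ?ltr0n //= mulrCA gtr_pMr //.
  by rewrite ltr_pdivrMr // mul1r ltr_nat ltn_neqAle i_neq ltn_ord.
move=> sin_gt0; apply/negbTE; rewrite negb_or; apply/andP; split; apply/negP.
  by rewrite eq_complex /= (gt_eqF sin_gt0) andbF.
by rewrite eq_complex /= oppr0 (gt_eqF sin_gt0) andbF.
Qed.

Lemma omegaX_inj (R : realType) q i j :
  (i < q)%N -> (j < q)%N -> omega R q.*2 ^+ i = omega R q.*2 ^+ j -> i = j.
Proof.
move=> i_lt j_lt eq_ij; have q_gt0 : (0 < q)%N by apply: leq_ltn_trans i_lt.
have /eqP : (omega R q.*2 ^+ 2) ^+ i = (omega R q.*2 ^+ 2) ^+ j.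
  by rewrite !(exprAC _ 2) eq_ij.
by rewrite (eq_prim_root_expr (omega2_prim R q_gt0)) !modn_small // => /eqP.
Qed.

Lemma prod_sub_prim (F : fieldType) (z : F) q (k : 'I_q) :
  q.-primitive_root z ->
  \prod_(r < q | r != k) (z ^+ k - z ^+ r) = (z ^+ k) ^+ q.-1 *+ q.
Proof.
move=> /factor_Xn_sub_1; rewrite big_mkord (bigD1 k) //=.
(* At the root z^k only the term of the product rule that differentiates X - z^k survives. *)
move=> /(congr1 (fun p : {poly F} => (p^`()).[z ^+ k])).
rewrite derivM derivXsubC mul1r derivB derivXn derivC subr0.
rewrite !(hornerE, hornerMn) /= subrr mul0r addr0 => <-.
by rewrite horner_prod; apply: eq_bigr => r _; rewrite !hornerE.
Qed.

(** * The leading block as a Vandermonde matrix, and its node polynomials *)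

Definition half_dft (R : realType) q : 'M[R[i]]_q :=
  \matrix_(i, j) omega R q.*2 ^+ (i * j).

Lemma half_dft_unit (R : realType) q : half_dft R q \in unitmx.
Proof.
have -> : half_dft R q = Vandermonde q (\row_j omega R q.*2 ^+ j).
  by apply/matrixP => i j; rewrite !mxE -exprM mulnC.
rewrite unitmxE unitfE det_Vandermonde; apply/prodf_neq0 => i _.
apply/prodf_neq0 => j i_lt_j; rewrite !mxE subr_eq0; apply/eqP.
by move=> /(omegaX_inj (ltn_ord j) (ltn_ord i)) j_eq; rewrite j_eq ltnn in i_lt_j.
Qed.

(** Up to a scalar, the k-th Lagrange basis polynomial for the nodes w^r, r < q. *)
Definition node_poly (R : realType) q (k : 'I_q) : {poly R[i]} :=
  \prod_(r < q | r != k) ('X - (omega R q.*2 ^+ r)%:P).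

Lemma size_node_poly (R : realType) q (k : 'I_q) : (size (node_poly R k) <= q)%N.
Proof.
have -> : node_poly R k =
    \prod_(r <- enum (predC1 k)) ('X - (omega R q.*2 ^+ r)%:P) by rewrite big_enum.
rewrite size_prod_XsubC -cardE cardC1 card_ord prednK //.
exact: leq_ltn_trans (ltn_ord k).
Qed.

(** Since (a - b)(- a - b) = -(a^2 - b^2), the factors pair up into differences of powers of the
    primitive q-th root w^2. *)
Lemma normc_node_polyM (R : realType) q (k : 'I_q) :
  normc (node_poly R k).[omega R q.*2 ^+ k] *
  normc (node_poly R k).[- omega R q.*2 ^+ k] = q%:R.
Proof.
rewrite -normcM !horner_prod -big_split normc_prod /=.
under eq_bigr => r _.
  rewrite !hornerXsubC -opprD mulrN normcN -subr_sqr !(exprAC _ _ 2); over.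
have q_gt0 : (0 < q)%N by exact: leq_ltn_trans (ltn_ord k).
rewrite -normc_prod prod_sub_prim; last exact: omega2_prim.
by rewrite normcMn -2!exprM normc_omegaX.
Qed.

Definition node_vec (R : realType) q (k : 'I_q) : 'cV[R[i]]_q :=
  \col_j (node_poly R k)`_j.

Lemma node_vec_horner (R : realType) q (k : 'I_q) (z : R[i]) :
  (node_poly R k).[z] = \sum_(j < q) node_vec R k j 0 * z ^+ j.
Proof.
rewrite (horner_coef_wide _ (size_node_poly R k)).
by apply: eq_bigr => j _; rewrite mxE.
Qed.

Lemma norm2_dft_node_vec (R : realType) q (k : 'I_q) :
  norm2 (half_dft R q *m node_vec R k) =
  normc (node_poly R k).[omega R q.*2 ^+ k].
Proof.
(* A Vandermonde matrix sends a coefficient vector to the values at the nodes. *)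
have mulE i :
    (half_dft R q *m node_vec R k) i 0 = (node_poly R k).[omega R q.*2 ^+ i].
  rewrite mxE node_vec_horner; apply: eq_bigr => j _.
  by rewrite mulrC [half_dft _ _ _ _]mxE -exprM.
apply/eqP; rewrite -(@eqrXn2 _ 2) ?norm2_ge0 ?normc_ge0 // norm2_sqr.
rewrite (bigD1 k) //= mulE big1 ?addr0 // => i i_neq.
rewrite mulE horner_prod (bigD1 i) //= hornerXsubC subrr mul0r.
by rewrite normc0 expr0n.
Qed.

(** The powers of -w^k have modulus 1, so the value there is at most the sum of the moduli of the
    coefficients; then Cauchy-Schwarz. *)
Lemma norm2_node_vec_ge (R : realType) q (k : 'I_q) :
  normc (node_poly R k).[- omega R q.*2 ^+ k] ^+ 2 <=
  q%:R * norm2 (node_vec R k) ^+ 2.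
Proof.
rewrite node_vec_horner norm2_sqr.
apply: le_trans (sqr_sum_le (fun j => normc (node_vec R k j 0))).
rewrite ler_pXn2r ?nnegrE ?normc_ge0 //; last first.
  by apply: sumr_ge0 => j _; exact: normc_ge0.
apply: le_trans (ler_normc_sum _ _ _) _; apply: ler_sum => j _.
by rewrite normcM normcX normcN normc_omegaX expr1n mulr1.
Qed.

Lemma kappa_half_dft_ge (R : realType) q (k : 'I_q) :
  normc (node_poly R k).[- omega R q.*2 ^+ k] ^+ 2 <= kappa (half_dft R q) * q%:R.
Proof.
set b := normc _.
pose M := half_dft R q; pose x : 'cV[R[i]]_q := delta_mx k 0.
have x1 : norm2 x = 1.
  apply/eqP; rewrite -(@eqrXn2 _ 2) ?norm2_ge0 // norm2_sqr expr1n (bigD1 k) //=.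
  rewrite mxE !eqxx normc1 expr1n big1 ?addr0 // => i /negbTE i_neq.
  by rewrite mxE i_neq normc0 expr0n.
have Mx : norm2 (M *m x) ^+ 2 = q%:R.
  rewrite norm2_sqr -colE; under eq_bigr do rewrite !mxE normc_omegaX expr1n.
  by rewrite sumr_const card_ord.
have b_ge0 : 0 <= b by exact: normc_ge0.
have b_le : b <= norm2 (M *m x) * norm2 (node_vec R k).
  rewrite -(@ler_pXn2r _ 2) ?nnegrE ?mulr_ge0 ?norm2_ge0 // exprMn Mx.
  exact: norm2_node_vec_ge.
(* With a = |p(w^k)| this reads b <= kappa a; multiplying by b and using a b = q gives the claim. *)
have := le_trans b_le (kappa_lower_bound x (node_vec R k) (half_dft_unit R q)).
rewrite x1 mul1r norm2_dft_node_vec => /(ler_wpM2r b_ge0).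
by rewrite -mulrA normc_node_polyM -expr2.
Qed.

(** * Lower bound for the product of cosine factors *)

Lemma cos_ge_quarter_pi (R : realType) (x : R) : `|x| <= pi / 4 -> 7 / 10 <= cos x.
Proof.
have pi_gt0 := pi_gt0 R; rewrite ler_norml => /andP[x_ge x_le].
have cos_ge0 : 0 <= cos x.
  by apply: cos_ge0_pihalf; apply/andP; split; move: pi_gt0 x_ge x_le; set p := pi; lra.
(* This gives 2 cos^2 x >= 1, and (7/10)^2 < 1/2. *)
have : 0 <= cos (x *+ 2).
  by apply: cos_ge0_pihalf; apply/andP; split; move: pi_gt0 x_ge x_le; set p := pi; lra.
by rewrite cos_mulr2n; nra.
Qed.

(** The two hypotheses on [r] and [k] say m |r - k| <= q without truncated subtraction; the uses are
    m = 4 and m = 2. *)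
Lemma node_angle_le (R : realType) (q m r k : nat) :
  (0 < q)%N -> (0 < m)%N -> (m * r <= m * k + q)%N -> (m * k <= m * r + q)%N ->
  `|(r%:R - k%:R) * (pi / q%:R)| <= pi / m%:R :> R.
Proof.
move=> q_gt0 m_gt0.
rewrite -!(ler_nat R) !natrD !natrM => le_rk le_kr.
have pi_gt0 := pi_gt0 R; have q_gt0' : 0 < q%:R :> R by rewrite ltr0n.
have m_gt0' : 0 < m%:R :> R by rewrite ltr0n.
have -> : pi / m%:R = q%:R / m%:R * (pi / q%:R) :> R.
  by move: (pi : R) => p; field; rewrite !gt_eqF.
rewrite normrM [`|pi / _|]ger0_norm; last by rewrite divr_ge0 // ltW.
rewrite ler_pM2r ?divr_gt0 //.
rewrite ler_pdivlMr // mulrC -{1}(ger0_norm (ltW m_gt0')) -normrM mulrBr ler_norml.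
by apply/andP; split; lra.
Qed.

Lemma card_near_nodes q (k : 'I_q) h :
  (h <= k)%N -> (k + h < q)%N ->
  (h.*2 <= #|[pred r : 'I_q | (r != k) && (k - h <= r <= k + h)%N]|)%N.
Proof.
move=> le_hk lt_khq.
(* Enumerates the window from k - h to k + h, with [bump k] jumping over its centre. *)
pose f (i : 'I_(h.*2)) : 'I_q := insubd k (bump k (k - h + i)).
have fE (i : 'I_(h.*2)) : f i = bump k (k - h + i) :> nat.
  rewrite val_insubd; case: ifP => // /negP[].
  by have := ltn_ord i; rewrite /bump; lia.
have f_inj : injective f.
  move=> i j /(congr1 val); rewrite /= !fE => /(can_inj (bumpK k)) eq_ij.
  by apply: val_inj => /=; lia.
rewrite -[h.*2]card_ord -(card_codom f_inj).
apply: subset_leq_card; apply/fintype.subsetP.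
move=> _ /codomP[i ->]; rewrite inE -val_eqE /= fE eq_sym neq_bump /=.
by have := ltn_ord i; rewrite /bump; lia.
Qed.

Lemma node_prod_ge (R : realType) q (k : 'I_q) : k = q./2 :> nat ->
  2 ^+ q.-1 * (17 / 10) ^+ (q %/ 4).*2 <=
  normc (node_poly R k).[- omega R q.*2 ^+ k] ^+ 2.
Proof.
move=> k_half; have q_gt0 : (0 < q)%N := leq_ltn_trans (leq0n k) (ltn_ord k).
pose h := (q %/ 4)%N.
pose near (r : 'I_q) := (k - h <= r <= k + h)%N.
rewrite horner_prod normc_prod -prodrXl.
under [leRHS]eq_bigr do rewrite hornerXsubC -opprD normcN normc_omegaD.
rewrite big_split /= prodr_const cardC1 card_ord ler_pM2l ?exprn_gt0 //.
(* Near indices have angle at most pi/4, so 1 + cos is at least 1 + 7/10. *)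
apply: (@le_trans _ _ (\prod_(r < q | r != k) if near r then 17 / 10 else 1)).
  rewrite -big_mkcondr /= prodr_const ler_weXn2l //; first lra.
  by apply: card_near_nodes; rewrite /h; lia.
apply: ler_prod => r _; apply/andP; split; first by case: ifP => _; lra.
have lt_rq := ltn_ord r.
case: ifP => [near_r|_].
  suff: 7 / 10 <= cos ((r%:R - k%:R) * (pi / q%:R) : R) by lra.
  apply: cos_ge_quarter_pi; apply: node_angle_le => //;
    by move: near_r => /andP[]; rewrite /h; lia.
(* As k is the middle index, 2 |r - k| <= q and the angle stays within pi/2. *)
rewrite lerDl; apply: cos_ge0_pihalf; rewrite -ler_norml.
by apply: node_angle_le => //; lia.
Qed.

(** * The bound for q = 1 and q >= 4 *)

Lemma cube_le_exp q : (3 < q)%N -> (q ^ 3 <= 2 ^ q.-1 * 8 ^ (q %/ 4))%N.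
Proof.
elim/ltn_ind: q => q IHq q_gt3.
have [q_lt8|q_ge8] := ltnP q 8.
  by case: q {IHq} q_gt3 q_lt8 => [|[|[|[|[|[|[|[|q]]]]]]]].
have := IHq (q - 4)%N ltac:(lia) ltac:(lia).
(* Passing from r to r + 4 multiplies the right side by 2^4 * 8 = 128, and the cube by at most 8
   because r >= 4. *)
have -> : q = (4 + (q - 4))%N by lia.
rewrite addKn; move: (q - 4)%N (leq_sub2r 4 q_ge8) => r r_ge4 IHr.
have -> : ((4 + r) %/ 4 = 1 + r %/ 4)%N by lia.
have -> : ((4 + r).-1 = 4 + r.-1)%N by lia.
rewrite !expnD mulnACA; apply: leq_trans (leq_mul (leqnn _) IHr).
rewrite (_ : 2 ^ 4 * 8 ^ 1 = 128)%N //; nia.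
Qed.

(** Squaring kappa q >= 2^(q-1) g with g = (17/10)^(2h) reduces the claim to q^3 <= 2^(q-1) g^2, and
    g^2 >= 8^h because (17/10)^4 = 8.3521. The cube inequality is a hypothesis so that q = 1 is
    covered too; it fails for q = 2 and q = 3. *)
Lemma kappa_half_dft_sqr_ge_cube (R : realType) q :
  (0 < q)%N -> (q ^ 3 <= 2 ^ q.-1 * 8 ^ (q %/ 4))%N ->
  2 ^+ q.-1 * q%:R <= kappa (half_dft R q) ^+ 2.
Proof.
move=> q_gt0; rewrite -(ler_nat R) natrM !natrX => cube_le.
have half_lt : (q./2 < q)%N by lia.
pose k := Ordinal half_lt.
have := le_trans (node_prod_ge R (erefl : k = q./2 :> nat)) (kappa_half_dft_ge R k).
set K := kappa _; set h := (q %/ 4)%N in cube_le *; set N : R := q%:R in cube_le *.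
have N_gt0 : 0 < N by rewrite ltr0n.
have p_gt0 : 0 < 2 ^+ q.-1 :> R by rewrite exprn_gt0.
rewrite -(@ler_pXn2r _ 2) ?nnegrE ?mulr_ge0 ?spectral_norm_ge0 ?exprn_ge0
  ?divr_ge0 ?ler0n //.
have g_ge : 8 ^+ h <= ((17 / 10) ^+ h.*2) ^+ 2 :> R.
  have g4_ge : 8 <= (17 / 10) ^+ (2 * 2) :> R by rewrite exprM !expr2; lra.
  rewrite -exprM (_ : (h.*2 * 2 = 2 * 2 * h)%N); last by lia.
  by rewrite exprM; apply: lerXn2r; rewrite ?nnegrE ?exprn_ge0 ?divr_ge0.
move: (_ ^+ h.*2) g_ge => g g_ge; rewrite !exprMn => le_KN.
have N2_gt0 : 0 < N ^+ 2 by rewrite exprn_gt0.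
rewrite -(ler_pM2r N2_gt0); apply: le_trans le_KN.
rewrite [X in _ <= X * _]expr2 -!mulrA ler_pM2l // -exprS.
by apply: le_trans cube_le _; rewrite ler_pM2l.
Qed.

(** * The cases q = 2 and q = 3, with explicit test vectors *)

Lemma kappa_half_dft_sqr_test (R : realType) q (x y : 'cV[R[i]]_q) (c : R) :
  0 < norm2 x ^+ 2 * norm2 (half_dft R q *m y) ^+ 2 ->
  c * (norm2 x ^+ 2 * norm2 (half_dft R q *m y) ^+ 2) <=
    norm2 (half_dft R q *m x) ^+ 2 * norm2 y ^+ 2 ->
  c <= kappa (half_dft R q) ^+ 2.
Proof.
move=> d_gt0 c_le; rewrite -(ler_pM2r d_gt0); apply: le_trans c_le _.
rewrite -!exprMn ler_pXn2r ?nnegrE ?mulr_ge0 ?norm2_ge0 ?spectral_norm_ge0 //.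
exact: kappa_lower_bound (half_dft_unit R q).
Qed.

Lemma kappa_half_dft_sqr2 (R : realType) : 4 <= kappa (half_dft R 2) ^+ 2.
Proof.
have w_i : omega R 2.*2 = (0 +i* 1)%C.
  by rewrite -[LHS]expr1 (omegaX R 2) mul1r cos_pihalf sin_pihalf.
(* |M x|^2 / |x|^2 = 6/2 and |y|^2 / |M y|^2 = 6/4, with product 9/2. *)
pose x : 'cV[R[i]]_2 := \col_j [:: 1; 0 +i* (-1)]%C`_j.
pose y : 'cV[R[i]]_2 := \col_j [:: (-1) +i* (-1); 2 +i* 0]%C`_j.
by apply: (@kappa_half_dft_sqr_test _ _ x y);
  rewrite !norm2_sqr !(big_ord_recl, big_ord0, mxE) w_i /=;
  rewrite !sqr_sqrtr ?addr_ge0 ?sqr_ge0 //; lra.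
Qed.

Lemma omega6 (R : realType) :
  exists2 s : R, s ^+ 2 = 3 / 4 & omega R 3.*2 = (2^-1 +i* s)%C.
Proof.
pose t : R := pi / 3.
have t3 : t + (t + t) = pi by rewrite /t; move: (pi : R) => p; lra.
have cos_t_ge0 : 0 <= cos t.
  by apply: cos_ge0_pihalf; rewrite /t; have := pi_gt0 R; move: (pi : R) => p; lra.
have cos_t : cos t = 2^-1.
  have := cospi R; rewrite -t3 !cosD sinD; have := cos2Dsin2 t.
  move: (cos t) (sin t) cos_t_ge0 => c s c_ge0 s2 c3.
  (* The triple-angle equation 4 c^3 - 3 c = -1, factored. *)
  have /eqP : (c + 1) * (c - 2^-1) ^+ 2 = 0 by nra.
  by rewrite mulf_eq0 sqrf_eq0 subr_eq0 (gt_eqF (_ : 0 < c + 1)) /= => [/eqP|]; last lra.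
exists (sin t); last by rewrite -[LHS]expr1 (omegaX R 3) mul1r cos_t.
by rewrite sin2cos2 cos_t; lra.
Qed.

Lemma kappa_half_dft_sqr3 (R : realType) : 12 <= kappa (half_dft R 3) ^+ 2.
Proof.
have [s s2 w_s] := omega6 R.
(* [x] is the conjugate of the middle row (1, w, w^2), and [y] is (w^2, w^4, 1), which the first and
   last rows annihilate. Here |M x|^2 = 17 and |M y|^2 = 1. *)
pose x : 'cV[R[i]]_3 := \col_j [:: 1 +i* 0; 2^-1 +i* (- s); (- 2^-1) +i* (- s)]%C`_j.
pose y : 'cV[R[i]]_3 := \col_j [:: (- 2^-1) +i* s; (- 2^-1) +i* (- s); 1 +i* 0]%C`_j.
have x2 : norm2 x ^+ 2 = 3.
  rewrite !norm2_sqr !(big_ord_recl, big_ord0, mxE) !normc_sqr /= sqrrN s2; lra.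
have y2 : norm2 y ^+ 2 = 3.
  rewrite !norm2_sqr !(big_ord_recl, big_ord0, mxE) !normc_sqr /= sqrrN s2; lra.
have w_2 : (2^-1 +i* s)%C ^+ 2 = ((- 2^-1) +i* s)%C.
  by apply/eqP; rewrite eq_complex /=; apply/andP; split; apply/eqP; lra.
have w_4 : (2^-1 +i* s)%C ^+ 4 = ((- 2^-1) +i* (- s))%C.
  rewrite (exprM _ 2 2) w_2.
  by apply/eqP; rewrite eq_complex /=; apply/andP; split; apply/eqP; lra.
have s4 : s ^+ 4 = 9 / 16 by rewrite (exprM _ 2 2) s2; lra.
have rowE (v : 'cV_3) : half_dft R 3 *m v = \col_j
    [:: v ord0 0 + v 1 0 + v ord_max 0;
        v ord0 0 + (2^-1 +i* s)%C * v 1 0 + ((- 2^-1) +i* s)%C * v ord_max 0;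
        v ord0 0 + ((- 2^-1) +i* s)%C * v 1 0 + ((- 2^-1) +i* (- s))%C * v ord_max 0]`_j.
  have i1 : lift ord0 (ord0 : 'I_2) = 1 by apply: val_inj.
  have i2 : lift ord0 (lift ord0 (ord0 : 'I_1)) = ord_max by apply: val_inj.
  apply/matrixP => i j; rewrite !mxE !big_ord_recl big_ord0 addr0 !mxE w_s i1 i2 ord1.
  by case: i => -[|[|[|]]] //= _; rewrite ?(expr0, expr1, mul1r, addrA) ?w_2 ?w_4.
have My2 : norm2 (half_dft R 3 *m y) ^+ 2 = 1.
  rewrite rowE norm2_sqr !(big_ord_recl, big_ord0, mxE) !normc_sqr /=; lra.
have Mx2 : 12 <= norm2 (half_dft R 3 *m x) ^+ 2.
  rewrite rowE norm2_sqr !(big_ord_recl, big_ord0, mxE) !normc_sqr /=; lra.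
apply: (@kappa_half_dft_sqr_test _ _ x y); rewrite x2 My2 ?y2; lra.
Qed.

(** * The bound for all positive q, and the theorem *)

Lemma kappa_half_dft_sqr_ge (R : realType) q :
  (0 < q)%N -> 2 ^+ q.-1 * q%:R <= kappa (half_dft R q) ^+ 2.
Proof.
move=> q_gt0; have [q_gt3|] := ltnP 3 q.
  exact: kappa_half_dft_sqr_ge_cube (cube_le_exp q_gt3).
case: q q_gt0 => [|[|[|[|q]]]] //= _ _.
- exact: (@kappa_half_dft_sqr_ge_cube _ 1).
- by apply: le_trans (kappa_half_dft_sqr2 R); rewrite expr1; lra.
- by apply: le_trans (kappa_half_dft_sqr3 R); rewrite expr2; lra.
Qed.

Unset Implicit Arguments.

Theorem theorem6p1 (R : realType) (n : nat)
    (n_gt0 : (0 < n)%N) (n_even : ~~ odd n) :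
  let Omega_q : 'M[R[i]]_(n./2) := leading_block (half_le n) (dft_mx R n) in
  Omega_q \in unitmx /\
  2 `^ (n%:R / 4 - 1) * Num.sqrt n%:R <= kappa Omega_q.
Proof.
move=> Omega_q; have n_double : n./2.*2 = n by rewrite even_halfK.
have -> : Omega_q = half_dft R n./2.
  by apply/matrixP => i j; rewrite !mxE n_double.
split; first exact: half_dft_unit.
have half_gt0 : (0 < n./2)%N by lia.
move: (n./2) half_gt0 n_double => q q_gt0 <- {Omega_q n n_gt0 n_even}.
rewrite -(@ler_pXn2r _ 2) ?nnegrE ?mulr_ge0 ?powR_ge0 ?sqrtr_ge0
  ?spectral_norm_ge0 //.
apply: le_trans (kappa_half_dft_sqr_ge R q_gt0).
rewrite exprMn sqr_sqrtr ?ler0n // -powR_mulrn ?powR_ge0 // -powRrM.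
(* For n = 2q the squared bound is 2^(q-2) * 2q = 2^(q-1) q. The subtraction of 1 stays in the
   reals, since q - 2 is negative at q = 1. *)
have -> : (q.*2%:R / 4 - 1) * 2 = q.-1%:R - 1 :> R.
  by rewrite -{1}(prednK q_gt0) -mul2n natrM -natr1; lra.
rewrite powRB; last by rewrite (@pnatr_eq0 R 2) implybT.
by rewrite powR_mulrn // powRr1 // -mul2n natrM mulrA divfK // pnatr_eq0.
Qed.
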